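(* Let $X_1,\dots,X_n$ be independent $d$-dimensional random variables with density $f$, let $x_0\in\mathbb{R}^d$, let $\alpha\in(0,1)$, and let $\mathcal K_n=\{K^1,\dots,K^{M_n}\}$ be the family of pairwise disjoint wedges with common vertex $x_0$ described in the context. For each $i=1,\dots,M_n$ consider the two tests: - the hypothesis ''$f$ is increasing on $K^i$'' is rejected if $T_{K^i}<-\tilde c_{K^i}(\alpha)$; - the hypothesis ''$f$ is decreasing on $K^i$'' is rejected if $T_{K^i}>\tilde c_{K^i}(\alpha)$. Assume that all these $2M_n$ tests are performed. Then the probability of at least one false rejection of any of the tests (i.e. of rejecting at least one hypothesis that is true) is at most $\alpha$.
   Context: Wedges. For $x_0,e\in\mathbb{R}^d$ with $\|e\|=1$ (Euclidean norm), fix an orthonormal basis $\{e_1,\dots,e_{d-1}\}$ of $(\mathrm{span}\{e\})^\perp$ and put $P_ex:=\langle x-x_0,e\rangle$. The wedge with vertex $x_0$, direction $e$, length $l>0$ and angle $\varphi\in(0,\pi/2)$ is $K(x_0,e,\varphi):=\{x: 0<P_ex\le l,\ \langle x-x_0,e_i\rangle\in[-\tan(\varphi)P_ex,\tan(\varphi)P_ex],\ i=1,\dots,d-1\}$. $f$ is increasing (resp. decreasing) on a wedge $K$ with vertex $x_0$ if $f(x_0+\tilde t_2e_0)\ge f(x_0+\tilde t_1e_0)$ (resp. $\le$) for all unit vectors $e_0$ and all $\tilde t_2>\tilde t_1\ge0$ with $x_0+\tilde t_2e_0\in K$. Family $\mathcal K_n$. Let $l_n=(\log(n)/n)^{1/(d+4)}$,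 let $C_1,C_2,\varepsilon>0$ be constants and $\varphi_n=\frac{C_2}{2}\log(n)^{-1}$. $\mathcal K_n$ consists of $M_n$ pairwise disjoint wedges $K^1,\dots,K^{M_n}$ with common vertex $x_0$, length $C_1\log(n)^{\frac{d-1}{d+4}}l_n$, angle $\varphi_n$ and unit directions $e_n^1,\dots,e_n^{M_n}$ chosen successively: $e_n^1$ is arbitrary; once $e_n^1,\dots,e_n^{i-1}$ are specified, whenever possible a unit vector $e_n^i$ is chosen such that $|\mathrm{angle}(e_n^i,e_n^j)|\ge(2+\varepsilon)\arctan(\sqrt{d-1}\tan(\varphi_n))$ for all $j<i$. Statistics. Let $\beta(z)=(2z-1)\mathbf 1_{(0,1)}(z)$ and $\Gamma(\delta)=\sqrt{2\log(\exp(1)/\delta)}$. For a wedge $K$ with direction $e$: $N$ is the number of observations in $K$; $X_{(1)},\dots,X_{(N)}$ are these observations ordered by increasing $P_e$; $K_N=\{x\in K:0<P_ex\le P_eX_{(N)}\}$; $\tilde F(z)=\mathbb P(P_eX\le z\mid N,X\in K_N,X_{(N)})$ for $X$ with density $f$ independent of the sample; $T_K=\sum_{j=1}^{N-1}\beta\big((P_eX_{(j)})^d/(P_eX_{(N)})^d\big)$ and $T_K^U=\sum_{j=1}^{N-1}\beta(\tilde F(P_eX_{(j)}))$. For the wedge $K^i$ write $N^i$, $T_{K^i}$, $T_{K^i}^U$. Critical values. $\tilde\kappa_n(\alpha)$ is defined by $$\mathbb P\Big(\max_{i=1,\dots,M_n}\Big(\sqrt{\tfrac{3}{N^i-1}}\,|T^U_{K^i}|-\Gamma\big(\tfrac{N^i}{n-1}\big)\Big)\le\tilde\kappa_n(\alpha)\,\Big|\,N^1,\dots,N^{M_n}\Big)=1-\alpha,$$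 and $\tilde c_{K^i}(\alpha)=\sqrt{\frac{N^i-1}{3}}\big(\tilde\kappa_n(\alpha)+\Gamma(\frac{N^i}{n-1})\big)$. Wedges with $N^i\le1$ are disregarded (no maximum term and no rejection). *)

(* Defs.v *)
From HB Require Import structures.
From mathcomp Require Import all_boot all_order all_algebra.
From mathcomp Require Import all_classical all_reals all_analysis.

Set Implicit Arguments.
Unset Strict Implicit.
Unset Printing Implicit Defensive.

Import Order.TTheory GRing.Theory Num.Theory.
Import numFieldNormedType.Exports.

Local Open Scope classical_set_scope.
Local Open Scope ring_scope.

(* Row vectors 'rV[R]_d carry the sigma-algebra generated by the coordinates,
   i.e. the Borel sets of R^d. *)
Definition rV_display : measure_display.
Proof. exact: default_measure_display. Qed.

Section measurable_rV.
Context (R : realType) (d : nat).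

Definition rV_coord (i : 'I_d) (x : 'rV[R]_d) : R := x 0 i.

Let rV_set0 : g_sigma_preimage rV_coord set0.
Proof. exact: sigma_algebra0. Qed.

Let rV_setC A : g_sigma_preimage rV_coord A -> g_sigma_preimage rV_coord (~` A).
Proof. exact: sigma_algebraC. Qed.

Let rV_bigcup (F : (set 'rV[R]_d)^nat) :
  (forall i, g_sigma_preimage rV_coord (F i)) ->
  g_sigma_preimage rV_coord (\bigcup_i (F i)).
Proof. exact: sigma_algebra_bigcup. Qed.

HB.instance Definition _ := @isMeasurable.Build rV_display
  'rV[R]_d (g_sigma_preimage rV_coord) rV_set0 rV_setC rV_bigcup.

Lemma measurable_rV_coord (i : 'I_d) :
  measurable_fun [set: 'rV[R]_d] (fun x : 'rV[R]_d => x 0 i).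
Proof.
move=> _ Y mY; rewrite setTI; apply: sub_sigma_algebra => /=.
rewrite -bigcup_seq/=; exists i => /=; first by rewrite mem_index_enum.
by exists Y => //; rewrite setTI.
Qed.

Lemma measurable_fun_rVP d1 (T1 : measurableType d1) (f : T1 -> 'rV[R]_d) :
  measurable_fun [set: T1] f <->
  forall i, measurable_fun [set: T1] (fun x => f x 0 i).
Proof.
split=> [mf i|mf].
  exact: (measurableT_comp (measurable_rV_coord i) mf).
move=> _ A mA.
suff : preimage_set_system [set: T1] f (g_sigma_preimage rV_coord) `<=` measurable.
  by apply; exists A.
rewrite -g_sigma_preimage_comp.
apply: smallest_sub; first exact: sigma_algebra_measurable.
rewrite -bigcup_seq; apply: bigcup_sub => i _ B [C mC <-].
exact: mf.
Qed.

End measurable_rV.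

Definition rV_cons (R : realType) (d : nat) (p : measurableTypeR R * 'rV[R]_d) :
    'rV[R]_d.+1 :=
  \row_i (if unlift ord0 i is Some j then p.2 0 j else p.1).

Lemma measurable_rV_cons (R : realType) (d : nat) :
  measurable_fun [set: measurableTypeR R * 'rV[R]_d] (@rV_cons R d).
Proof.
apply/measurable_fun_rVP => i.
rewrite (_ : (fun x => _) = fun p : measurableTypeR R * 'rV[R]_d =>
   (if unlift ord0 i is Some j then p.2 0 j else p.1)); last first.
  by apply/funext => p; rewrite mxE.
case: (unlift ord0 i) => [j|].
  exact: (measurableT_comp (measurable_rV_coord j) measurable_snd).
exact: measurable_fst.
Qed.


Definition rV_uncons (R : realType) (d : nat) (x : 'rV[R]_d.+1) :
    measurableTypeR R * 'rV[R]_d :=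
  (x 0 ord0, \row_j x 0 (lift ord0 j)).

Lemma measurable_rV_uncons (R : realType) (d : nat) :
  measurable_fun [set: 'rV[R]_d.+1] (@rV_uncons R d).
Proof.
apply/measurable_fun_pairP; split => /=.
  exact: (measurable_rV_coord ord0).
apply/measurable_fun_rVP => i /=.
rewrite (_ : (fun x => _) = fun x : 'rV[R]_d.+1 => x 0 (lift ord0 i)).
  exact: measurable_rV_coord.
by apply/funext => x; rewrite mxE.
Qed.

Lemma rV_consK (R : realType) (d : nat) :
  cancel (@rV_cons R d) (@rV_uncons R d).
Proof.
move=> [a v]; rewrite /rV_uncons /rV_cons !mxE unlift_none/=; congr pair.
by apply/rowP => j; rewrite !mxE liftK.
Qed.

Section lebesgue_cons.
Local Open Scope ereal_scope.
Context (R : realType) (d : nat).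
Variable mu : {sigma_finite_measure set 'rV[R]_d -> \bar R}.

Definition lebesgue_cons : set 'rV[R]_d.+1 -> \bar R :=
  pushforward (lebesgue_measure \x mu) (@rV_cons R d).

Let nu := measure_function_pushforward__canonical__measure_function_Measure
  (lebesgue_measure \x mu) (@measurable_rV_cons R d).

HB.instance Definition _ := isMeasure.Build _ _ _ lebesgue_cons
  (@measure0 _ _ _ nu) (@measure_ge0 _ _ _ nu)
  (@measure_semi_sigma_additive _ _ _ nu).

Let lebesgue_cons_sigma_finite : sigma_finite setT lebesgue_cons.
Proof.
have /sigma_finiteP[F [TF ndF Foo]] := sigma_finiteT (@lebesgue_measure R).
have /sigma_finiteP[G [TG ndG Goo]] := sigma_finiteT mu.
exists (fun k => @rV_uncons R d @^-1` (F k `*` G k)).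
  rewrite -preimage_bigcup (_ : \bigcup_k _ = setT) ?preimage_setT//.
  rewrite -setXTT TF TG predeqE => -[x y]; split.
    by move=> [n _ []/= ? ?]; split; exists n.
  move=> [/= [n _ Fnx] [k _ Gky]]; exists (maxn n k) => //; split.
  - by move: x Fnx; exact/subsetPset/ndF/leq_maxl.
  - by move: y Gky; exact/subsetPset/ndG/leq_maxr.
move=> k; have [mF Fk] := Foo k; have [mG Gk] := Goo k; split.
  rewrite -[X in measurable X]setTI; apply: measurable_rV_uncons => //.
  exact: measurableX.
rewrite /lebesgue_cons /pushforward -comp_preimage.
rewrite (_ : _ \o _ = id); last by apply/funext => x; exact: rV_consK.
by rewrite preimage_id product_measure1E// lte_mul_pinfty// ge0_fin_numE.
Qed.

HB.instance Definition _ := Measure_isSigmaFinite.Build _ _ _ lebesgue_cons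
  lebesgue_cons_sigma_finite.

End lebesgue_cons.

(* d-dimensional Lebesgue measure, as an iterated product of the
   one-dimensional one. *)
Fixpoint lebesgue_rV (R : realType) (d : nat) :
    {sigma_finite_measure set 'rV[R]_d -> \bar R} :=
  if d is d'.+1 then lebesgue_cons (lebesgue_rV R d') else \d_(0 : 'rV[R]_0).

Lemma lebesgue_rV_box (R : realType) (d : nat) (A : 'I_d -> set R) :
  (forall i, measurable (A i)) ->
  lebesgue_rV R d [set x | forall i, A i (x 0 i)] =
  (\prod_(i < d) lebesgue_measure (A i))%E.
Proof.
elim: d A => [|d IH] A mA.
  by rewrite big_ord0 /= diracE mem_set// => -[].
pose B := [set v : 'rV[R]_d | forall i, A (lift ord0 i) (v 0 i)].
have mB : measurable B.
  rewrite (_ : B =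
      \bigcap_(i in [set: 'I_d]) ((fun x : 'rV[R]_d => x 0 i) @^-1` A (lift ord0 i))).
    apply: fin_bigcap_measurable => // i _.
    by rewrite -[X in measurable X]setTI; exact: measurable_rV_coord.
  by apply/seteqP; split => [x h i _|x h i]; [exact: h|exact: (h i)].
rewrite big_ord_recl -(IH (fun i => A (lift ord0 i)))//=.
rewrite -product_measure1E//; last exact: mA.
rewrite /lebesgue_cons /pushforward.
congr (_ _); apply/seteqP; split => -[a v] /=.
  move=> h; split => [|i] /=.
    by have := h ord0; rewrite mxE unlift_none.
  by have := h (lift ord0 i); rewrite mxE liftK.
move=> [a0 h] i; rewrite mxE.
by case: unliftP => [j ->|->].
Qed.

Section geometry.
Context (R : realType) (d : nat).
Implicit Types (x y e u v : 'rV[R]_d) (b : 'I_d.-1 -> 'rV[R]_d).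
Implicit Types (K : set 'rV[R]_d) (f : 'rV[R]_d -> R).

Definition dotp u v : R := \sum_i u 0 i * v 0 i.

(* The library norm `|u| on matrices is the sup norm, hence this definition. *)
Definition enorm u : R := Num.sqrt (dotp u u).

Definition angle u v : R := acos (dotp u v / (enorm u * enorm v)).

Definition proj x0 e x : R := dotp (x - x0) e.

(* For a unit vector e, d - 1 orthonormal vectors orthogonal to e form a basis
   of the orthogonal complement of span {e}. *)
Definition orthobasis e b : Prop :=
  (forall i, dotp (b i) e = 0) /\
  (forall i j, dotp (b i) (b j) = (i == j)%:R).

Definition wedge x0 e b (l phi : R) : set 'rV[R]_d :=
  [set x | 0 < proj x0 e x <= l /\
     forall i, - (tan phi * proj x0 e x) <= dotp (x - x0) (b i)
                 <= tan phi * proj x0 e x].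

Definition increasing_on x0 K f : Prop :=
  forall (e0 : 'rV[R]_d) (t1 t2 : R), enorm e0 = 1 -> 0 <= t1 -> t1 < t2 ->
    K (x0 + t2 *: e0) -> f (x0 + t1 *: e0) <= f (x0 + t2 *: e0).

Definition decreasing_on x0 K f : Prop :=
  forall (e0 : 'rV[R]_d) (t1 t2 : R), enorm e0 = 1 -> 0 <= t1 -> t1 < t2 ->
    K (x0 + t2 *: e0) -> f (x0 + t2 *: e0) <= f (x0 + t1 *: e0).

Definition separated (eps phi : R) u v : Prop :=
  (2 + eps) * atan (Num.sqrt (d%:R - 1) * tan phi) <= `|angle u v|.

(* Directions are chosen as long as possible, so the family cannot be extended.
   In the last clause disjointness of the new wedge follows from the angle
   condition when d >= 2; for d = 1 the angle condition is void and
   disjointness is what makes the selection stop. *)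
Definition wedge_family x0 (l phi eps : R) (M : nat)
    (e : 'I_M -> 'rV[R]_d) (b : 'I_M -> 'I_d.-1 -> 'rV[R]_d) : Prop :=
  [/\ forall i, enorm (e i) = 1 /\ orthobasis (e i) (b i),
      forall i j : 'I_M, (j < i)%N -> separated eps phi (e i) (e j),
      trivIset setT (fun i => wedge x0 (e i) (b i) l phi) &
      ~ exists e' b', [/\ enorm e' = 1, orthobasis e' b',
          forall j, separated eps phi e' (e j) &
          forall j, wedge x0 e' b' l phi `&` wedge x0 (e j) (b j) l phi = set0]].

End geometry.

Definition wedge_length (R : realType) (d n : nat) (C1 : R) : R :=
  C1 * ln n%:R `^ ((d%:R - 1) / (d%:R + 4)) *
  (ln n%:R / n%:R) `^ (1 / (d%:R + 4)).

Definition wedge_angle (R : realType) (n : nat) (C2 : R) : R :=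
  C2 / 2 * (ln n%:R)^-1.

Section conditional_probability.
Context dT (T : measurableType dT) (R : realType).

Definition cond_prob (mu : set T -> \bar R) (A B : set T) : R :=
  fine (mu (A `&` B)) / fine (mu B).

Definition independent_RVs (P : probability T R) d' (T' : measurableType d')
    (n : nat) (X : 'I_n -> {RV P >-> T'}) : Prop :=
  forall (J : {set 'I_n}) (A : 'I_n -> set T'), (forall i, measurable (A i)) ->
    P (\bigcap_(i in [set` J]) (X i @^-1` A i)) =
    (\prod_(i in J) P (X i @^-1` A i))%E.

End conditional_probability.

Section density.
Context (R : realType) (d : nat) (f : 'rV[R]_d -> R).

Definition density_law (A : set 'rV[R]_d) : \bar R :=
  (\int[lebesgue_rV R d]_(x in A) (f x)%:E)%E.

Definition is_density : Prop :=
  [/\ measurable_fun [set: 'rV[R]_d] f, forall x, 0 <= f x &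
      density_law [set: 'rV[R]_d] = 1%E].

Definition has_density dT (T : measurableType dT) (P : probability T R)
    (X : {RV P >-> 'rV[R]_d}) : Prop :=
  forall A, measurable A -> P (X @^-1` A) = density_law A.

End density.

Definition beta (R : realType) (z : R) : R :=
  if 0 < z < 1 then 2 * z - 1 else 0.

Definition Gamma (R : realType) (delta : R) : R :=
  Num.sqrt (2 * ln (expR 1 / delta)).

(* Statistics of a sample X : 'I_n -> R^d for a wedge K with vertex x0 and
   direction e. Order statistics are indexed from 0, so X_(j) is
   nth x0 ordered_obs j.-1, and X_(N) is the last entry. *)
Section statistics.
Context (R : realType) (d n : nat) (f : 'rV[R]_d -> R) (x0 e : 'rV[R]_d)
  (K : set 'rV[R]_d) (X : 'I_n -> 'rV[R]_d).

Definition ordered_obs : seq 'rV[R]_d :=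
  sort (fun x y => proj x0 e x <= proj x0 e y)
    [seq X i | i <- enum 'I_n & X i \in K].

Definition nb_obs : nat := size ordered_obs.

Definition order_proj (j : nat) : R := proj x0 e (nth x0 ordered_obs j).

Definition last_proj : R := order_proj nb_obs.-1.

Definition wedge_trunc : set 'rV[R]_d :=
  [set x | K x /\ 0 < proj x0 e x <= last_proj].

(* The extra variable with density f is independent of the sample, so
   conditioning on N and X_(N) amounts to freezing wedge_trunc at its observed
   value. *)
Definition Ftilde (z : R) : R :=
  cond_prob (density_law f) [set x | proj x0 e x <= z] wedge_trunc.

Definition T_stat : R :=
  \sum_(j < nb_obs.-1) beta (order_proj j ^+ d / last_proj ^+ d).

Definition TU_stat : R := \sum_(j < nb_obs.-1) beta (Ftilde (order_proj j)).

End statistics.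

Section multiple_test.
Context (R : realType) (d n M : nat) (f : 'rV[R]_d -> R) (x0 : 'rV[R]_d)
  (e : 'I_M -> 'rV[R]_d) (K : 'I_M -> set 'rV[R]_d).
Implicit Types (X : 'I_n -> 'rV[R]_d) (kappa : {ffun 'I_M -> nat} -> R).

Definition counts X : {ffun 'I_M -> nat} :=
  [ffun i => nb_obs x0 (e i) (K i) X].

Definition penalty (N : nat) : R := Gamma (N%:R / (n%:R - 1)).

Definition max_stat X : \bar R :=
  (\big[maxe/-oo]_(i < M | (1 < counts X i)%N)
     (Num.sqrt (3 / ((counts X i)%:R - 1)) *
        `|TU_stat f x0 (e i) (K i) X| - penalty (counts X i))%:E)%E.

(* kappa is the quantile as a function of (N^1, ..., N^M); the conditional
   probability given the discrete counts is the elementary one. If all wedges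
   are disregarded the maximum is empty, no quantile exists, and kappa is
   irrelevant since nothing is rejected. *)
Definition is_critical_value dT (T : measurableType dT) (P : probability T R)
    (X : 'I_n -> {RV P >-> 'rV[R]_d}) (alpha : R) kappa : Prop :=
  forall k : {ffun 'I_M -> nat}, (exists i, (1 < k i)%N) ->
    let Nk := [set w | counts (fun i => X i w) = k] in
    P Nk != 0%E ->
    cond_prob P [set w | (max_stat (fun i => X i w) <= (kappa k)%:E)%E] Nk =
    1 - alpha.

Definition crit kappa X (i : 'I_M) : R :=
  Num.sqrt (((counts X i)%:R - 1) / 3) *
  (kappa (counts X) + penalty (counts X i)).

Definition rejects_increasing kappa X (i : 'I_M) : Prop :=
  (1 < counts X i)%N /\ T_stat x0 (e i) (K i) X < - crit kappa X i.

Definition rejects_decreasing kappa X (i : 'I_M) : Prop :=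
  (1 < counts X i)%N /\ T_stat x0 (e i) (K i) X > crit kappa X i.

Definition false_rejection kappa X : Prop :=
  exists i : 'I_M,
    increasing_on x0 (K i) f /\ rejects_increasing kappa X i \/
    decreasing_on x0 (K i) f /\ rejects_decreasing kappa X i.

End multiple_test.

(* Main.v *)
Require Import Defs.
From mathcomp Require Import all_boot all_order all_algebra.
From mathcomp Require Import all_classical all_reals all_analysis.
From mathcomp Require Import measurable_realfun ring.

Set Implicit Arguments.
Unset Strict Implicit.
Unset Printing Implicit Defensive.

Import Order.TTheory GRing.Theory Num.Theory.
Import numFieldNormedType.Exports.

Local Open Scope classical_set_scope.
Local Open Scope ring_scope.

(* If f is increasing on the wedge K, dilating K towards its vertex by the factor
   z / l <= 1 decreases f and scales Lebesgue measure by (z / l)^d, so that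
   Ftilde z <= z^d / l^d; as beta is increasing inside the unit interval, T^U <= T
   (and T <= T^U if f is decreasing).  The jumps of beta at 0 and 1 are only met
   when an observation has the same value of z |-> P (X in K, P_e X <= z) as some
   smaller z, which almost surely does not happen.  Hence a false rejection forces
   |T^U| to exceed the critical value for some wedge, i.e. the maximum in the
   definition of kappa to exceed kappa; given the counts this has probability
   alpha. *)

(* all_analysis also exports a [proj]. *)
Local Notation proj := Defs.proj.

(** * Affine images of Lebesgue measure *)

Lemma measurable_affine (R : realType) (v c : R) :
  measurable_fun [set: measurableTypeR R]
    (fun x : measurableTypeR R => v + c * x : measurableTypeR R).
Proof. by apply: measurable_funD => //; exact: mulrl_measurable. Qed.

(** By uniqueness of Lebesgue measure it suffices to compare the scaled pushforward on the intervals
    []a, b]]; since [c > 0], their preimages are again intervals of this type. *)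
Lemma lebesgue_measure_affine (R : realType) (v c : R)
    (A : set (measurableTypeR R)) : 0 < c -> measurable A ->
  lebesgue_measure A = (c%:E * lebesgue_measure ((fun x => (v + c * x)%R) @^-1` A))%E.
Proof.
move=> c0 mA.
pose m1 := measure_function_pushforward__canonical__measure_function_Measure
  (@lebesgue_measure R) (measurable_affine v c).
have c0' : 0 <= c := ltW c0.
apply: (@lebesgue_measure_unique R
  (mscale (NngNum c0') m1 : {measure set _ -> \bar R})) => // _ [[a b] _ <-] /=.
rewrite /mscale/= /pushforward.
rewrite (_ : _ @^-1` _ = `](a - v) / c, (b - v) / c]%classic); last first.
  apply/seteqP; split => x; rewrite /= !in_itv/= ltr_pdivrMr// ler_pdivlMr//;
    by rewrite ltrBlDl lerBrDl (mulrC x).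
rewrite !lebesgue_measure_itv/= !lte_fin ltr_pM2r ?invr_gt0// ltrD2r.
case: ifPn => _; last by rewrite mule0.
by rewrite -!EFinB -EFinM; congr EFin; field; rewrite gt_eqF.
Qed.

(** Serves as the induction step on the dimension: [h] stands for the affine map in the remaining
    coordinates. The preimage of a rectangle is a rectangle, and rectangles determine the product
    measure. *)
Lemma product_lebesgue_affine (R : realType) dT (T : measurableType dT)
    (mu : {sigma_finite_measure set T -> \bar R}) (h : T -> T) (v c k : R)
    (X : set (measurableTypeR R * T)) :
  measurable_fun [set: T] h -> 0 < c -> 0 <= k ->
  (forall B, measurable B -> mu B = (k%:E * mu (h @^-1` B))%E) ->
  measurable X ->
  (lebesgue_measure \x mu)%E X = ((c * k)%:E *
    (lebesgue_measure \x mu) ((fun p => (v + c * p.1, h p.2)%R) @^-1` X))%E.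
Proof.
move=> mh c0 k0 muE mX.
have mH : measurable_fun [set: measurableTypeR R * T]
    (fun p : measurableTypeR R * T =>
      (v + c * p.1, h p.2) : measurableTypeR R * T).
  apply/measurable_fun_pairP; split => /=.
    exact: (measurableT_comp (measurable_affine v c) measurable_fst).
  exact: (measurableT_comp mh measurable_snd).
have ck0 : 0 <= c * k by rewrite mulr_ge0// ltW.
pose m1 := measure_function_pushforward__canonical__measure_function_Measure
  (lebesgue_measure \x mu)%E mH.
apply: (@product_measure_unique _ _ _ _ _ lebesgue_measure mu
  (mscale (NngNum ck0) m1 : {measure set _ -> \bar R})) => // B C mB mC.
transitivity ((c * k)%:E * (lebesgue_measure \x mu)
    (((fun x => (v + c * x)%R) @^-1` B) `*` (h @^-1` C)))%E; first by [].
rewrite product_measure1E; last 2 first.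
- by rewrite -[X in measurable X]setTI; exact: measurable_affine.
- by rewrite -[X in measurable X]setTI; exact: mh.
rewrite EFinM muleACA -muE//.
by rewrite -(@lebesgue_measure_affine R v).
Qed.

Lemma measurable_rV_affine (R : realType) (d : nat) (v : 'rV[R]_d) (c : R) :
  measurable_fun [set: 'rV[R]_d] (fun x => v + c *: x).
Proof.
apply/measurable_fun_rVP => i.
under eq_fun do rewrite !mxE.
apply: measurable_funD => //; apply: measurable_funM => //.
exact: measurable_rV_coord.
Qed.

(** Along [rV_cons] the map splits into its first coordinate and an affine map one dimension lower,
    so each coordinate contributes one factor [c]. In dimension 0 there is a single point and the
    map is the identity. *)
Lemma lebesgue_rV_affine (R : realType) (d : nat) (v : 'rV[R]_d) (c : R)
    (A : set 'rV[R]_d) : 0 < c -> measurable A ->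
  lebesgue_rV R d A =
  ((c ^+ d)%:E * lebesgue_rV R d ((fun x => (v + c *: x)%R) @^-1` A))%E.
Proof.
move=> c0; elim: d v A => [|d IH] v A mA.
  rewrite expr0 mul1e; congr (lebesgue_rV R 0 _).
  by apply/seteqP; split => x; rewrite /preimage/mkset [v + _]thinmx0 [x]thinmx0.
have affE p : v + c *: rV_cons p =
    rV_cons (v 0 ord0 + c * p.1, \row_j v 0 (lift ord0 j) + c *: p.2).
  apply/rowP => i; rewrite !mxE.
  by case: unliftP => [j ->|-> //]; rewrite !mxE.
have lebE B : lebesgue_rV R d.+1 B =
    (lebesgue_measure \x lebesgue_rV R d)%E (@rV_cons R d @^-1` B) by [].
rewrite !lebE exprS.
rewrite (product_lebesgue_affine (v 0 ord0)
  (measurable_rV_affine (\row_j v 0 (lift ord0 j)) c) c0 (exprn_ge0 d (ltW c0))).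
- rewrite (_ : _ @^-1` (@rV_cons R d @^-1` A) =
    @rV_cons R d @^-1` ((fun x => v + c *: x) @^-1` A))//.
  by apply/seteqP; split => p; rewrite /preimage/mkset affE.
- by move=> B mB; exact: IH.
- by rewrite -[X in measurable X]setTI; exact: measurable_rV_cons.
Qed.

(** * Mass of dilated wedges *)

Section wedge_scaling.
Context (R : realType) (d : nat).
Implicit Types (f : 'rV[R]_d -> R) (x y e u v : 'rV[R]_d).

Lemma density_law_affine f v (c : R) (A : set 'rV[R]_d) :
  measurable_fun setT f -> (forall x, 0 <= f x) -> 0 < c -> measurable A ->
  density_law f A = ((c ^+ d)%:E *
    \int[lebesgue_rV R d]_(x in (fun x => (v + c *: x)%R) @^-1` A)
      (f (v + c *: x)%R)%:E)%E.
Proof.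
move=> mf f0 c0 mA.
have cd0 : 0 <= c ^+ d by rewrite exprn_ge0// ltW.
have mfE : measurable_fun A (EFin \o f).
  by apply/measurable_EFinP; exact: measurable_funTS.
pose m1 := measure_function_pushforward__canonical__measure_function_Measure
  (lebesgue_rV R d) (measurable_rV_affine v c).
rewrite /density_law (eq_measure_integral
  (mscale (NngNum cd0) m1 : {measure set _ -> \bar R})); last first.
  by move=> B mB _; exact: lebesgue_rV_affine.
rewrite ge0_integral_mscale//; last by move=> x _; rewrite lee_fin.
congr (_ * _)%E; apply: ge0_integral_pushforward => //.
  exact: measurable_rV_affine.
by move=> x _; rewrite lee_fin.
Qed.

Lemma measurable_dotp u v : measurable_fun setT (fun x => dotp (x - u) v).
Proof.
apply: measurable_sum => i; apply: measurable_funM => //.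
under eq_fun do rewrite !mxE.
by apply: measurable_funB => //; exact: measurable_rV_coord.
Qed.

Lemma measurable_proj u e : measurable_fun setT (proj u e).
Proof. exact: measurable_dotp. Qed.

Lemma dotpZl c u v : dotp (c *: u) v = c * dotp u v.
Proof.
by rewrite /dotp mulr_sumr; apply: eq_bigr => i _; rewrite mxE mulrA.
Qed.

Lemma dotpZr c u v : dotp u (c *: v) = c * dotp u v.
Proof.
by rewrite /dotp mulr_sumr; apply: eq_bigr => i _; rewrite mxE mulrCA.
Qed.

Lemma measurable_wedge x0 e b (l phi : R) : measurable (wedge x0 e b l phi).
Proof.
have mp := measurable_proj x0 e.
rewrite (_ : wedge _ _ _ _ _ = (proj x0 e @^-1` `]0, l]%classic) `&`
  \bigcap_(i in [set: 'I_d.-1])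
    ([set x | - (tan phi * proj x0 e x) <= dotp (x - x0) (b i)] `&`
     [set x | dotp (x - x0) (b i) <= tan phi * proj x0 e x])).
  apply: measurableI; first by rewrite -[X in measurable X]setTI; exact: mp.
  apply: fin_bigcap_measurable => // i _.
  have mt : measurable_fun setT (fun x => tan phi * proj x0 e x).
    exact: measurable_funM.
  apply: measurableI; rewrite -[X in measurable X]setTI.
    apply: (measurable_fun_ler _ _) => //; [exact: measurable_funN|].
    exact: measurable_dotp.
  by apply: (measurable_fun_ler _ _) => //; exact: measurable_dotp.
apply/seteqP; split => x; rewrite /wedge/= in_itv/=.
  by move=> [? h]; split => // i _; move/andP: (h i).
by move=> [? h]; split => // i; apply/andP; exact: h.
Qed.

(** The unnormalised distribution function of the projection on [K]; dividing it by its value at the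
    last order statistic gives [Ftilde] up to that point. *)
Definition mass (mu : set 'rV[R]_d -> \bar R) x0 e (K : set 'rV[R]_d) (t : R) : R :=
  fine (mu (K `&` [set x | proj x0 e x <= t])).

End wedge_scaling.

Section wedge_mass.
Context (R : realType) (d : nat).
Implicit Types (f : 'rV[R]_d -> R) (x y e u v : 'rV[R]_d).

Lemma dotp_gt0 u : u != 0 -> 0 < dotp u u.
Proof.
move=> u0; rewrite lt0r; apply/andP; split; last first.
  by apply: sumr_ge0 => i _; rewrite -expr2 sqr_ge0.
apply: contra u0; rewrite psumr_eq0; last by move=> i _; rewrite -expr2 sqr_ge0.
move=> /allP h; apply/eqP/rowP => i; rewrite mxE.
by have /= := h i (mem_index_enum i); rewrite mulf_eq0 orbb => /eqP.
Qed.

Lemma enorm_normalize u : u != 0 -> enorm ((enorm u)^-1 *: u) = 1.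
Proof.
move=> u0; have uu := dotp_gt0 u0.
rewrite {1}/enorm dotpZl dotpZr mulrA -invfM -expr2 sqr_sqrtr ?ltW//.
by rewrite mulVf ?sqrtr1// gt_eqF.
Qed.

(** Both points lie on one ray from [x0], at distances [c * t] and [t], and only the farther one has
    to belong to [K]. *)
Lemma increasing_on_dilation f x0 (K : set 'rV[R]_d) x (c : R) :
  increasing_on x0 K f -> K x -> x != x0 -> 0 < c <= 1 ->
  f ((1 - c) *: x0 + c *: x) <= f x.
Proof.
(* [increasing_on] compares strictly ordered distances only, so [c = 1] is separate. *)
move=> fK Kx xx0 /andP[c0]; rewrite le_eqVlt => /predU1P[->|c1].
  by rewrite subrr scale0r add0r scale1r.
have u0 : x - x0 != 0 by rewrite subr_eq0.
set t := enorm (x - x0); have t0 : 0 < t by rewrite sqrtr_gt0 dotp_gt0.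
have xE : x = x0 + t *: (t^-1 *: (x - x0)).
  by rewrite scalerA divff ?gt_eqF// scale1r addrC subrK.
rewrite (_ : _ + _ = x0 + (c * t) *: (t^-1 *: (x - x0))); last first.
  rewrite scalerA mulfK ?gt_eqF// scalerBr scalerBl scale1r.
  by rewrite addrA addrAC.
rewrite [in leRHS]xE; apply: fK; first exact: enorm_normalize.
- by rewrite mulr_ge0 ?ltW.
- by rewrite gtr_pMl.
- by rewrite -xE.
Qed.

Lemma decreasing_on_opp f x0 (K : set 'rV[R]_d) :
  decreasing_on x0 K f -> increasing_on x0 K (fun x => - f x).
Proof. by move=> fK e0 t1 t2 *; rewrite lerN2; exact: fK. Qed.

Lemma dotp_dilation x0 x (c : R) v :
  dotp ((1 - c) *: x0 + c *: x - x0) v = c * dotp (x - x0) v.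
Proof.
rewrite -dotpZl; congr dotp.
by rewrite scalerBl scale1r scalerBr addrAC [x0 - _]addrC addrK addrC.
Qed.

Context (mu : probability 'rV[R]_d R) (f : 'rV[R]_d -> R).
Hypotheses (mf : measurable_fun setT f) (f0 : forall x, 0 <= f x).
Hypothesis muE : forall A, measurable A -> mu A = density_law f A.
Context (x0 e : 'rV[R]_d) (b : 'I_d.-1 -> 'rV[R]_d) (L phi : R).
Local Notation K := (wedge x0 e b L phi).
Local Notation G := (mass mu x0 e K).

Lemma measurable_wedge_le t : measurable (K `&` [set x | proj x0 e x <= t]).
Proof.
apply: measurableI; first exact: measurable_wedge.
rewrite -[X in measurable X]setTI.
by apply: (measurable_fun_ler _ _) => //; exact: measurable_proj.
Qed.

Lemma massE t : mu (K `&` [set x | proj x0 e x <= t]) = (G t)%:E.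
Proof.
by rewrite fineK// fin_num_measure//; exact: measurable_wedge_le.
Qed.

(** Change of variables along the dilation of ratio [z / l] about [x0]. The side constraints of the
    wedge are homogeneous, so the part of [K] below height [z] pulls back to the part below [l];
    [l <= L] makes the length constraint automatic for both. *)
Lemma mass_dilation (z l : R) : 0 < z <= l -> l <= L ->
  ((G z)%:E = (((z / l) ^+ d)%:E *
    \int[lebesgue_rV R d]_(x in K `&` [set x | (proj x0 e x <= l)%R])
      (f ((1 - z / l) *: x0 + (z / l) *: x))%:E))%E.
Proof.
move=> /andP[z0 zl] lL.
have l0 : 0 < l by exact: lt_le_trans zl.
have c0 : 0 < z / l by rewrite divr_gt0.
rewrite -massE muE; last exact: measurable_wedge_le.
rewrite (density_law_affine ((1 - z / l) *: x0) mf f0 c0); last first.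
  exact: measurable_wedge_le.
congr (_ * integral _ _ _)%E.
apply/seteqP; split => x; rewrite /preimage /wedge /proj/=.
  rewrite !dotp_dilation//.
  move=> [[/andP[p1 p2] p3] p4]; split; last first.
    by move: p4; rewrite mulrAC ler_pdivrMr// ler_pM2l.
  split.
    move: p1; rewrite pmulr_rgt0// => ->/=.
    by move: p4; rewrite mulrAC ler_pdivrMr// ler_pM2l// => /le_trans; apply.
  move=> i; move: (p3 i); rewrite dotp_dilation// mulrCA -mulrN.
  by rewrite !ler_pM2l.
move=> [[/andP[p1 p2] p3] p4].
rewrite !dotp_dilation//.
have zz : z / l * dotp (x - x0) e <= z.
  by rewrite mulrAC ler_pdivrMr// ler_pM2l.
split => //; split.
  by rewrite mulr_gt0//= (le_trans zz)// (le_trans zl).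
by move=> i; rewrite dotp_dilation// mulrCA -mulrN !ler_pM2l.
Qed.

(** The comparison of [g] and [h] may exclude the vertex, which is not in [K] because its projection
    is 0. *)
Let int_le (g h : 'rV[R]_d -> R) l :
  measurable_fun setT g -> measurable_fun setT h ->
  (forall x, 0 <= g x) ->
  (forall x, K x -> x != x0 -> g x <= h x) ->
  (\int[lebesgue_rV R d]_(x in K `&` [set x | (proj x0 e x <= l)%R]) (g x)%:E
  <= \int[lebesgue_rV R d]_(x in K `&` [set x | (proj x0 e x <= l)%R]) (h x)%:E)%E.
Proof.
move=> mg mh g0 gh; apply: ge0_le_integral.
- exact: measurable_wedge_le.
- by move=> x _; rewrite lee_fin.
- by apply/measurable_EFinP; exact: measurable_funTS.
- by apply/measurable_EFinP; exact: measurable_funTS.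
- move=> x [Kx _]; rewrite lee_fin; apply: gh => //.
  apply/eqP => xx0; have [/andP[+ _] _] := Kx.
  rewrite xx0 /Defs.proj subrr /dotp big1 ?ltxx// => i _.
  by rewrite mxE mul0r.
Qed.

Let mf_dilation c : measurable_fun setT (fun x => f ((1 - c) *: x0 + c *: x)).
Proof. by apply: measurableT_comp => //; exact: measurable_rV_affine. Qed.

Let ratio01 (z l : R) : 0 < z <= l -> 0 < z / l <= 1.
Proof.
move=> /andP[z0 zl]; have l0 := lt_le_trans z0 zl.
by rewrite divr_gt0//= ler_pdivrMr// mul1r.
Qed.

(** After [mass_dilation] both sides are [(z / l) ^+ d] times an integral over the same slice, and
    dilating the argument lowers [f]. *)
Lemma mass_increasing (z l : R) : increasing_on x0 K f ->
  0 < z <= l -> l <= L -> G z <= (z / l) ^+ d * G l.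
Proof.
move=> fK zl lL; have c01 := ratio01 zl.
have [c0 _] := andP c01.
rewrite -lee_fin (mass_dilation zl lL) EFinM -(massE l) muE; last first.
  exact: measurable_wedge_le.
rewrite lee_wpmul2l ?lee_fin ?(exprn_ge0 _ (ltW c0))//.
apply: int_le => // x Kx xx0; exact: (increasing_on_dilation fK).
Qed.

Lemma mass_decreasing (z l : R) : decreasing_on x0 K f ->
  0 < z <= l -> l <= L -> (z / l) ^+ d * G l <= G z.
Proof.
move=> fK zl lL; have c01 := ratio01 zl.
have [c0 _] := andP c01.
rewrite -lee_fin (mass_dilation zl lL) EFinM -(massE l) muE; last first.
  exact: measurable_wedge_le.
rewrite lee_wpmul2l ?lee_fin ?(exprn_ge0 _ (ltW c0))//.
apply: int_le => // x Kx xx0.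
by have := increasing_on_dilation (decreasing_on_opp fK) Kx xx0 c01; rewrite lerN2.
Qed.

Lemma mass_homo : {homo G : s t / s <= t}.
Proof.
move=> s t st; rewrite -lee_fin -!massE le_measure ?inE//.
- exact: measurable_wedge_le.
- exact: measurable_wedge_le.
- by move=> x [Kx] /= xs; split => //=; exact: le_trans st.
Qed.

Lemma mass0 : G 0 = 0.
Proof.
apply/eqP; rewrite -eqe -massE (_ : _ `&` _ = set0) ?measure0//.
apply/seteqP; split => x //= [[/andP[p0 _] _]].
by rewrite leNgt p0.
Qed.

End wedge_mass.

(** * Plateaus of the projected distribution *)

Lemma negligible_bigcup_countType dT (T : measurableType dT) (R : realType)
    (mu : {measure set T -> \bar R}) (I : countType) (F : I -> set T) :
  (forall i, mu.-negligible (F i)) -> mu.-negligible (\bigcup_i F i).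
Proof.
move=> F0; apply: (@negligibleS _ _ _ mu
    (\bigcup_k (if unpickle k is Some i then F i else set0))).
  by move=> x [i _ Fix]; exists (pickle i) => //; rewrite pickleK.
apply: negligible_bigcup => k; case: (unpickle k) => [i|]; first exact: F0.
exact: negligible_set0.
Qed.

Section plateaus.
Context (R : realType) (d : nat) (mu : probability 'rV[R]_d R).
Context (x0 e : 'rV[R]_d) (b : 'I_d.-1 -> 'rV[R]_d) (L phi : R).
Local Notation K := (wedge x0 e b L phi).
Local Notation G := (mass mu x0 e K).

(** The slab is the difference of two nested slices, which have equal mass because [G] is
    nondecreasing. *)
Lemma slab_negligible (r s : R) : r <= s -> G s <= G r ->
  mu.-negligible (K `&` [set x | r < proj x0 e x <= s]).
Proof.
move=> rs Gsr.
have E : K `&` [set x | r < proj x0 e x <= s] =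
    (K `&` [set x | proj x0 e x <= s]) `\` (K `&` [set x | proj x0 e x <= r]).
  apply/seteqP; split => x /=.
    by move=> [Kx /andP[rx xs]]; split => // -[_]; rewrite leNgt rx.
  move=> [[Kx xs] nx]; split => //; rewrite xs andbT ltNge.
  by apply/negP => xr; exact: nx.
have mle t := @measurable_wedge_le R d x0 e b L phi t.
rewrite E; apply/negligibleP; first exact: measurableD.
rewrite measureD// ?ltey_eq ?fin_num_measure//.
have subrs : K `&` [set x | proj x0 e x <= r] `<=`
    K `&` [set x | proj x0 e x <= s].
  by move=> x [Kx /= xr]; split; [exact: Kx|exact: le_trans rs].
rewrite (setIidr subrs).
transitivity ((G s)%:E - (G r)%:E)%E.
  by congr (_ - _)%E; exact: massE.
by apply/eqP; rewrite -EFinB eqe subr_eq0 eq_le Gsr/=; exact: mass_homo.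
Qed.

(** Countably many null slabs cover all points where [G] is flat to the left. Choose a rational [q]
    between [z] and the height of [x]. If the plateau continues to the right of [x], a second
    rational closes the slab ([F1]); otherwise [x] sits at the right end of the plateau, and this
    end is determined by [q] ([F2]). *)
Lemma plateau_negligible :
  mu.-negligible [set x | K x /\ exists2 z, z < proj x0 e x &
                                  G (proj x0 e x) <= G z].
Proof.
pose F1 (q : rat * rat) := K `&` [set x |
  ratr q.1 < proj x0 e x <= ratr q.2 /\ G (ratr q.2) <= G (ratr q.1)].
pose F2 (q : rat) := K `&` [set x | [/\ ratr q < proj x0 e x,
  G (proj x0 e x) <= G (ratr q) &
  forall t, proj x0 e x < t -> G (ratr q) < G t]].
apply: (@negligibleS _ _ _ mu ((\bigcup_q F1 q) `|` (\bigcup_q F2 q))).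
  move=> x [Kx [z zx Gz]].
  have [q /[!in_itv]/= /andP[zq qx]] := rat_in_itvoo zx.
  have Gxq : G (proj x0 e x) <= G (ratr q).
    by apply: (le_trans Gz); apply: mass_homo; exact: ltW.
  have [[t xt Gt]|noext] := pselect (exists2 t, proj x0 e x < t & G t <= G (ratr q)).
    have [p /[!in_itv]/= /andP[xp pt]] := rat_in_itvoo xt.
    left; exists (q, p) => //=; split => //=; split; first by rewrite qx ltW.
    by apply: (le_trans _ Gt); apply: mass_homo; exact: ltW.
  right; exists q => //; split => //=; split => // t xt.
  by rewrite ltNge; apply/negP => Gt; apply: noext; exists t.
apply: negligibleU; apply: negligible_bigcup_countType => q.
  have [/andP[qq Gq]|h] := boolP ((ratr q.1 <= ratr q.2 :> R) && (G (ratr q.2) <= G (ratr q.1))).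
    apply: negligibleS (slab_negligible qq Gq) => x [Kx [? _]].
    by split.
  apply: negligibleS (negligible_set0 _) => x [Kx [/andP[qx xq] Gq]].
  by move: h; rewrite Gq andbT => /negP; apply; rewrite ltW// (lt_le_trans qx).
(* One point [x] of [F2 q] bounds the heights of all others: a higher point would have mass above
   [G (ratr q)]. *)
have [[x [Kx [qx Gx xext]]]|F20] := pselect (exists x, F2 q x).
  apply: negligibleS (slab_negligible (ltW qx) Gx) => y [Ky [qy Gy yext]].
  split => //=; rewrite qy/= leNgt; apply/negP => xy.
  by have := xext _ xy; rewrite ltNge Gy.
by apply: negligibleS (negligible_set0 _) => x F2x; apply: F20; exists x.
Qed.

End plateaus.

(** * Comparison of the two statistics *)

Section order_statistics.
Context (R : realType) (d n : nat) (x0 e : 'rV[R]_d) (K : set 'rV[R]_d).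
Context (X : 'I_n -> 'rV[R]_d).
Local Notation s := (ordered_obs x0 e K X).
Local Notation N := (nb_obs x0 e K X).
Local Notation l := (last_proj x0 e K X).

Let s0 := [seq X i | i <- enum 'I_n & X i \in K].

Let perm_s : perm_eq s s0.
Proof. by rewrite perm_sort. Qed.

Lemma mem_ordered_obs x :
  reflect (exists2 i, X i \in K & x = X i) (x \in s).
Proof.
rewrite (perm_mem perm_s); apply: (iffP mapP) => -[i].
  by rewrite mem_filter => /andP[Ki _] ->; exists i.
by move=> Ki ->; exists i => //; rewrite mem_filter Ki mem_enum.
Qed.

Lemma nb_obsE : N = \sum_(i < n) (X i \in K : nat).
Proof.
rewrite /nb_obs (perm_size perm_s) size_map size_filter.
by rewrite -sum1_count -big_mkcond/= big_enum_cond.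
Qed.

Lemma last_proj_mem : (0 < N)%N -> exists2 i, X i \in K & l = proj x0 e (X i).
Proof.
move=> N0; have : nth x0 s N.-1 \in s by rewrite mem_nth// prednK.
by move=> /mem_ordered_obs[i Ki E]; exists i => //; rewrite /last_proj /order_proj E.
Qed.

Lemma proj_le_last i : X i \in K -> proj x0 e (X i) <= l.
Proof.
move=> Ki; have : X i \in s by apply/mem_ordered_obs; exists i.
move=> /(nthP x0)[j js <-].
pose le_proj (x y : 'rV[R]_d) := proj x0 e x <= proj x0 e y.
have le_tr : transitive le_proj by move=> y x z; exact: le_trans.
have le_refl : reflexive le_proj by move=> x; exact: lexx.
have s_sorted : sorted le_proj s.
  by apply: sort_sorted => x y; exact: le_total.
have N0 : (0 < N)%N by apply: leq_ltn_trans js.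
apply: (sorted_leq_nth le_tr le_refl x0 s_sorted); rewrite ?inE//.
  by rewrite prednK.
by rewrite -ltnS prednK.
Qed.

(** Removes the sorting, so that measurability can be read off a finite maximum. Without
    observations the default entry [x0] has projection 0, the neutral value of this maximum. *)
Lemma last_proj_max : (forall x, K x -> 0 <= proj x0 e x) ->
  l = \big[Num.max/0]_(i < n | X i \in K) proj x0 e (X i).
Proof.
move=> K0; have l0 : 0 <= l.
  have [N0|] := posnP N.
    rewrite /last_proj /order_proj nth_default -/N ?N0//.
    rewrite /Defs.proj subrr /dotp big1// => i _.
    by rewrite mxE mul0r.
  by move=> /last_proj_mem[i /set_mem Ki ->]; exact: K0.
apply/eqP; rewrite eq_le; apply/andP; split; last first.
  by apply/bigmax_leP; split => // i; exact: proj_le_last.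
have [N0|/last_proj_mem[i Ki ->]] := posnP N.
  rewrite /last_proj /order_proj nth_default -/N ?N0//.
  rewrite /Defs.proj subrr {1}/dotp big1 => [|i _]; last by rewrite mxE mul0r.
  exact: bigmax_ge_id.
exact: (le_bigmax_cond _ (fun i => proj x0 e (X i)) Ki).
Qed.

(* Both statistics omit the last order statistic, but its summand would vanish:
   [beta] is zero at the end points of the unit interval. *)
Lemma sum_order_proj (g : R -> R) : g l = 0 ->
  \sum_(j < N.-1) g (order_proj x0 e K X j) =
  \sum_(i < n | X i \in K) g (proj x0 e (X i)).
Proof.
move=> gl; transitivity (\sum_(j < N) g (order_proj x0 e K X j)).
  have [->//|N0] := posnP N.
  rewrite -[in RHS](prednK N0) big_ord_recr/=.
  by rewrite [X in _ + X](_ : _ = 0) ?addr0// prednK.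
rewrite -(big_mkord xpredT (fun j => g (order_proj x0 e K X j))) -/N.
rewrite -(big_nth x0 xpredT (fun x => g (proj x0 e x))) (perm_big _ perm_s).
by rewrite big_map big_filter big_enum_cond.
Qed.

Lemma T_statE : T_stat x0 e K X =
  \sum_(i < n | X i \in K) Defs.beta (proj x0 e (X i) ^+ d / l ^+ d).
Proof.
rewrite -(sum_order_proj (g := fun z => Defs.beta (z ^+ d / l ^+ d)))//.
(* At the last order statistic the quotient is 1, or 0 if the denominator vanishes; [beta] is zero
   at both. *)
rewrite /Defs.beta; case: (eqVneq (l ^+ d) 0) => [->|l0].
  by rewrite mul0r ltxx.
by rewrite divff// ltxx andbF.
Qed.

Lemma TU_statE f : TU_stat f x0 e K X =
  \sum_(i < n | X i \in K) Defs.beta (Ftilde f x0 e K X (proj x0 e (X i))).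
Proof.
rewrite -(sum_order_proj (g := fun z => Defs.beta (Ftilde f x0 e K X z)))//.
rewrite /Ftilde /cond_prob (_ : _ `&` _ = wedge_trunc x0 e K X); last first.
  by apply: setIidr => x [_ /andP[]].
rewrite /Defs.beta; set m := fine _; case: (eqVneq m 0) => [->|m0].
  by rewrite mul0r ltxx.
by rewrite divff// ltxx andbF.
Qed.

End order_statistics.

Section wedge_statistics.
Context (R : realType) (d n : nat) (mu : probability 'rV[R]_d R).
Context (f : 'rV[R]_d -> R).
Hypotheses (mf : measurable_fun setT f) (f0 : forall x, 0 <= f x).
Hypothesis muE : forall A, measurable A -> mu A = density_law f A.
Context (x0 e : 'rV[R]_d) (b : 'I_d.-1 -> 'rV[R]_d) (L phi : R).
Local Notation K := (wedge x0 e b L phi).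
Local Notation G := (mass mu x0 e K).
Context (X : 'I_n -> 'rV[R]_d).
Local Notation l := (last_proj x0 e K X).

Lemma Ftilde_mass z : z <= l -> Ftilde f x0 e K X z = G z / G l.
Proof.
move=> zl; rewrite /Ftilde /cond_prob.
have truncE : wedge_trunc x0 e K X = K `&` [set x | proj x0 e x <= l].
  apply/seteqP; split => x [Kx] /=; first by move=> /andP[].
  by move=> xl; split => //; rewrite xl andbT; have [/andP[]] := Kx.
have interE : [set x | proj x0 e x <= z] `&` wedge_trunc x0 e K X =
    K `&` [set x | proj x0 e x <= z].
  rewrite truncE; apply/seteqP; split => x /=; first by move=> [? []].
  by move=> [Kx xz]; split => //; split => //; exact: le_trans zl.
by rewrite interE truncE -!muE//; exact: measurable_wedge_le.
Qed.

(* The plateau condition, almost surely true of a sample, keeps [Ftilde]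
   strictly inside the unit interval, away from the jumps of [beta]. *)
Hypothesis d0 : (0 < d)%N.
Hypothesis noplateau : forall i, X i \in K ->
  forall z, z < proj x0 e (X i) -> G z < G (proj x0 e (X i)).

Let beta_le (a c : R) : 0 < a < 1 -> 0 < c < 1 -> a <= c ->
  Defs.beta a <= Defs.beta c.
Proof.
by rewrite /Defs.beta => -> -> ac; rewrite lerD2r ler_pM2l.
Qed.

(** An observation at the maximal height makes both arguments of [beta] equal to 1. For any other,
    the absence of plateaus at [z] gives [0 < G z], and at the last observation it gives
    [G z < G l], so both arguments are interior. *)
Let term_cases i : X i \in K ->
  let z := proj x0 e (X i) in
  [/\ 0 < z <= l, l <= L, 0 < G l &
      Defs.beta (z ^+ d / l ^+ d) = Defs.beta (G z / G l) \/
      (0 < z ^+ d / l ^+ d < 1) /\ (0 < G z / G l < 1)].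
Proof.
move=> Ki /=; set z := proj _ _ _.
have := set_mem Ki; move=> [/andP[z0 _] _].
have zl := proj_le_last x0 e Ki; rewrite -/z in zl.
have N0 : (0 < nb_obs x0 e K X)%N.
  by rewrite nb_obsE (bigD1 i)//= Ki.
have [j Kj lE] := last_proj_mem N0.
have := set_mem Kj; move=> [/andP[l0 lL] _]; rewrite -lE in l0 lL.
have Gz0 : 0 < G z by rewrite -(mass0 mu x0 e b L phi); exact: noplateau.
have Gl0 : 0 < G l.
  by rewrite -(mass0 mu x0 e b L phi) lE; apply: noplateau => //; rewrite -lE.
split => //; first by rewrite z0.
have [->|zl'] := eqVneq z l.
  by left; rewrite !divff// gt_eqF// exprn_gt0.
right; have {}zl' : z < l by rewrite lt_neqAle zl'.
rewrite !divr_gt0 ?exprn_gt0//= !ltr_pdivrMr ?exprn_gt0// !mul1r; split.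
  by rewrite ltrXn2r -?lt0n// ltW.
by rewrite lE; apply: noplateau => //; rewrite -lE.
Qed.

(** Termwise: [mass_increasing] bounds [G z / G l] by [(z / l) ^+ d], and [beta] is increasing on
    the open unit interval. *)
Lemma TU_le_T : increasing_on x0 K f -> TU_stat f x0 e K X <= T_stat x0 e K X.
Proof.
move=> fK; rewrite TU_statE T_statE; apply: ler_sum => i Ki.
have [zl lL Gl0 [->|[? ?]]] := term_cases Ki.
  by rewrite Ftilde_mass//; case/andP: zl.
rewrite Ftilde_mass; last by case/andP: zl.
apply: beta_le => //; rewrite ler_pdivrMr// -expr_div_n.
exact: (mass_increasing mf f0 muE fK zl lL).
Qed.

Lemma T_le_TU : decreasing_on x0 K f -> T_stat x0 e K X <= TU_stat f x0 e K X.
Proof.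
move=> fK; rewrite TU_statE T_statE; apply: ler_sum => i Ki.
have [zl lL Gl0 [->|[? ?]]] := term_cases Ki.
  by rewrite Ftilde_mass//; case/andP: zl.
rewrite Ftilde_mass; last by case/andP: zl.
apply: beta_le => //; rewrite ler_pdivlMr// -expr_div_n.
exact: (mass_decreasing mf f0 muE fK zl lL).
Qed.

End wedge_statistics.

(** * Measurability of the statistics *)

Section measurability.
Context dT (T : measurableType dT) (R : realType).

Lemma measurable_fun_invr (g : T -> R) :
  measurable_fun setT g -> measurable_fun setT (fun t => (g t)^-1).
Proof.
(* Squaring makes the base of the real power nonnegative; at zeros of [g] both sides are 0. *)
move=> mg; rewrite (_ : (fun t => _) = fun t => g t * (g t ^+ 2) `^ (- 1)).
  apply: measurable_funM => //.
  apply: (measurableT_comp (f := fun x : R => x `^ (-1))).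
    exact: measurable_powR.
  exact: measurable_funX.
apply/funext => t; rewrite powR_inv1 ?sqr_ge0//.
have [->|g0] := eqVneq (g t) 0; first by rewrite invr0 mul0r.
by rewrite expr2 invfM mulrA divff// mul1r.
Qed.

Lemma measurable_fun_beta (g : T -> R) :
  measurable_fun setT g -> measurable_fun setT (fun t => Defs.beta (g t)).
Proof.
move=> mg; apply: measurable_fun_ifT => //.
  by apply: measurable_and; exact: measurable_fun_ltr.
by apply: measurable_funB => //; exact: measurable_funM.
Qed.

Context (d n : nat) (x0 e : 'rV[R]_d) (K : set 'rV[R]_d).
Context (X : 'I_n -> T -> 'rV[R]_d).
Hypotheses (mK : measurable K) (mX : forall i, measurable_fun setT (X i)).

Lemma measurable_sum_obs (g : 'I_n -> T -> R) :
  (forall i, measurable_fun setT (g i)) ->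
  measurable_fun setT (fun t => \sum_(i < n | X i t \in K) g i t).
Proof.
move=> mg; under eq_fun do rewrite big_mkcond.
apply: measurable_sum => i; apply: measurable_fun_ifT => //.
by apply: (measurable_fun_bool true); rewrite setTI preimage_mem_true
  -[X in measurable X]setTI; exact: mX.
Qed.

Lemma measurable_nb_obs (k : nat) :
  measurable [set t | nb_obs x0 e K (X^~ t) = k].
Proof.
have mN : measurable_fun setT (fun t => \sum_(i < n | X i t \in K) (1 : R)).
  exact: measurable_sum_obs.
rewrite (_ : mkset _ =
    (fun t => \sum_(i < n | X i t \in K) (1 : R)) @^-1` [set k%:R]).
  by rewrite -[X in measurable X]setTI; exact: mN.
have NE t : \sum_(i < n | X i t \in K) (1 : R) = (nb_obs x0 e K (X^~ t))%:R.
  rewrite nb_obsE natr_sum big_mkcond; apply: eq_bigr => i _.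
  by case: (_ \in _).
apply/seteqP; split => t /=; rewrite NE; first by move=> ->.
by move/eqP; rewrite eqr_nat => /eqP.
Qed.

Lemma measurable_proj_obs i : measurable_fun setT (fun t => proj x0 e (X i t)).
Proof. exact: (measurableT_comp (measurable_proj x0 e) (mX i)). Qed.

Hypothesis K0 : forall x, K x -> 0 <= proj x0 e x.

Lemma measurable_last_proj :
  measurable_fun setT (fun t => last_proj x0 e K (X^~ t)).
Proof.
under eq_fun do rewrite (last_proj_max _ K0) bigmax_mkcond.
elim: (index_enum _) => [|i r IHr].
  by under eq_fun do rewrite big_nil; exact: measurable_cst.
under eq_fun do rewrite big_cons.
apply: measurable_maxr => //; apply: measurable_fun_ifT => //.
  by apply: (measurable_fun_bool true); rewrite setTI preimage_mem_true
    -[X in measurable X]setTI; exact: mX.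
exact: measurable_proj_obs.
Qed.

Lemma measurable_T_stat :
  measurable_fun setT (fun t => T_stat x0 e K (X^~ t)).
Proof.
under eq_fun do rewrite T_statE.
apply: measurable_sum_obs => i; apply: measurable_fun_beta.
apply: measurable_funM; first exact/measurable_funX/measurable_proj_obs.
by apply: measurable_fun_invr; apply: measurable_funX; exact: measurable_last_proj.
Qed.

End measurability.

(** [Ftilde] is a quotient of values of [mass], which is measurable because it is nondecreasing. *)
Lemma measurable_TU_stat dT (T : measurableType dT) (R : realType) (d n : nat)
    (mu : probability 'rV[R]_d R) (f : 'rV[R]_d -> R)
    (x0 e : 'rV[R]_d) (b : 'I_d.-1 -> 'rV[R]_d) (L phi : R)
    (X : 'I_n -> T -> 'rV[R]_d) :
  (forall A, measurable A -> mu A = density_law f A) ->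
  (forall i, measurable_fun setT (X i)) ->
  measurable_fun setT
    (fun t => TU_stat f x0 e (wedge x0 e b L phi) (X^~ t)).
Proof.
move=> muE mX; set K := wedge x0 e b L phi.
have mK : measurable K by exact: measurable_wedge.
have mG (g : T -> R) : measurable_fun setT g ->
    measurable_fun setT (fun t => mass mu x0 e K (g t)).
  move=> mg; apply: (measurableT_comp _ mg).
  by apply: nondecreasing_measurable => // s t; exact: mass_homo.
rewrite (_ : (fun t => _) = fun t => \sum_(i < n | X i t \in K) Defs.beta
    (mass mu x0 e K (proj x0 e (X i t)) /
     mass mu x0 e K (last_proj x0 e K (X^~ t)))).
  apply: measurable_sum_obs => // i; apply: measurable_fun_beta.
  apply: measurable_funM; first exact/mG/measurable_proj_obs.
  apply: measurable_fun_invr; apply: mG; apply: measurable_last_proj => //.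
  by move=> x [/andP[/ltW]].
apply/funext => t; rewrite TU_statE; apply: eq_bigr => i Ki.
by rewrite (Ftilde_mass muE)//; exact: proj_le_last.
Qed.

(** Law of total probability over the finite partition by the values of [c]; it turns a bound
    conditional on the counts into an unconditional one. *)
Lemma probability_le_cells dT (T : measurableType dT) (R : realType)
    (P : probability T R) (I : finType) (c : T -> I) (A : set T) (a : R) :
  0 <= a -> (forall k, measurable (A `&` [set t | c t = k])) ->
  (forall k, measurable [set t | c t = k]) ->
  (forall k, P (A `&` [set t | c t = k]) <= a%:E * P [set t | c t = k])%E ->
  (P A <= a%:E)%E.
Proof.
move=> a0 mAc mc Pc.
have tI (F : I -> set T) : (forall k, F k `<=` [set t | c t = k]) ->
    trivIset setT F.
  move=> Fc; apply/trivIsetP => i j _ _ /eqP ij; apply/seteqP; split => // t.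
  by move=> [/Fc/= ci /Fc/= cj]; case: ij; rewrite -ci -cj.
rewrite (_ : A = \bigcup_(k in [set: I]) (A `&` [set t | c t = k])); last first.
  by apply/seteqP; split => [t At|t [k _ []]//]; exists (c t).
rewrite (measure_fin_bigcup _ finite_finset)//; last by apply: tI => k t [].
apply: (@le_trans _ _ (\sum_(k \in [set: I]) (a%:E * P [set t | c t = k]))%E).
  by apply: lee_fsum; [exact: finite_finset|move=> k _; exact: Pc].
rewrite -ge0_mule_fsumr// -(measure_fin_bigcup _ finite_finset)//; last by apply: tI => k.
rewrite -[leRHS]mule1 lee_wpmul2l ?lee_fin//.
apply: probability_le1; apply: fin_bigcup_measurable => [|k _] //.
exact: finite_finset.
Qed.

(** * False rejections *)

(** With [m = N - 1], the factors in the critical value and in the maximum statistic are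
    reciprocal. *)
Lemma sqrt_ratio_lt (R : realType) (m a c : R) : 0 < m ->
  Num.sqrt (m / 3) * c < a -> c < Num.sqrt (3 / m) * a.
Proof.
move=> m0 ca; have s0 : 0 < Num.sqrt (3 / m) by rewrite sqrtr_gt0 divr_gt0.
rewrite (_ : c = Num.sqrt (3 / m) * (Num.sqrt (m / 3) * c)) ?ltr_pM2l//.
rewrite mulrA -sqrtrM ?divr_ge0 ?ltW//.
by rewrite mulrA divfK ?gt_eqF// divff// sqrtr1 mul1r.
Qed.

Section false_rejection_bound.
Context (R : realType) (dT : measure_display) (T : measurableType dT).
Context (P : probability T R) (d n : nat) (d0 : (0 < d)%N) (n0 : (0 < n)%N).
Context (f : 'rV[R]_d -> R) (hf : is_density f).
Context (X : 'I_n -> {RV P >-> 'rV[R]_d}) (hXf : forall i, has_density f (X i)).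
Context (x0 : 'rV[R]_d) (M : nat) (e : 'I_M -> 'rV[R]_d).
Context (b : 'I_M -> 'I_d.-1 -> 'rV[R]_d) (L phi : R).
Local Notation K := (fun i => wedge x0 (e i) (b i) L phi).
(** All observations have density [f], so the law of the first one represents their common law as a
    probability measure. *)
Local Notation mu := (distribution P (X (Ordinal n0))).
Local Notation Xat := (fun w i => X i w).

Let mX i : measurable_fun setT (X i).
Proof. exact: measurable_funP. Qed.

Let muE A : measurable A -> mu A = density_law f A.
Proof. by move=> mA; exact: hXf. Qed.

Let mK i : measurable (K i).
Proof. exact: measurable_wedge. Qed.

Let K0 i x : K i x -> 0 <= proj x0 (e i) x.
Proof. by move=> [/andP[/ltW]]. Qed.

Lemma plateau_obs_negligible : P.-negligible [set w | exists i j,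
  X j w \in K i /\ exists2 z, z < proj x0 (e i) (X j w) &
    mass mu x0 (e i) (K i) (proj x0 (e i) (X j w)) <= mass mu x0 (e i) (K i) z].
Proof.
pose B i := [set x | K i x /\ exists2 z, z < proj x0 (e i) x &
    mass mu x0 (e i) (K i) (proj x0 (e i) x) <= mass mu x0 (e i) (K i) z].
apply: (@negligibleS _ _ _ P (\bigcup_i \bigcup_j (X j @^-1` B i))).
  by move=> w [i [j [/set_mem Kij h]]]; exists i => //; exists j.
apply: negligible_bigcup_countType => i.
apply: negligible_bigcup_countType => j.
have [A [mA muA BA]] := plateau_negligible mu x0 (e i) (b i) L phi.
exists (X j @^-1` A); split; last by move=> w; exact: BA.
  by rewrite -[X in measurable X]setTI; exact: mX.
exact: etrans (hXf j mA) (etrans (esym (muE mA)) muA).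
Qed.

Lemma measurable_counts (k : {ffun 'I_M -> nat}) :
  measurable [set w | counts x0 e K (Xat w) = k].
Proof.
rewrite (_ : mkset _ = \bigcap_(i in [set: 'I_M])
    [set w | nb_obs x0 (e i) (K i) (Xat w) = k i]).
  by apply: fin_bigcap_measurable => // i _; exact: measurable_nb_obs.
apply/seteqP; split => w /=; first by move=> <- i _; rewrite ffunE.
by move=> h; apply/ffunP => i; rewrite ffunE h.
Qed.

(** Once the counts are fixed, the index set of the maximum and the penalties are deterministic,
    which leaves finitely many conditions on [TU_stat]. *)
Lemma measurable_max_stat_counts (k : {ffun 'I_M -> nat}) (c : R) :
  measurable ([set w | (max_stat f x0 e K (Xat w) <= c%:E)%E] `&`
    [set w | counts x0 e K (Xat w) = k]).
Proof.
rewrite (_ : _ `&` _ = [set w | counts x0 e K (Xat w) = k] `&`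
  \bigcap_(i in [set i : 'I_M | (1 < k i)%N])
    [set w | Num.sqrt (3 / ((k i)%:R - 1)) * `|TU_stat f x0 (e i) (K i) (Xat w)|
             <= c + penalty R n (k i)]).
  apply: measurableI; first exact: measurable_counts.
  apply: fin_bigcap_measurable => [|i _]; first exact: finite_finset.
  rewrite -[X in measurable X]setTI; apply: (measurable_fun_ler _ _) => //.
  apply: measurable_funM => //; apply: measurableT_comp => //.
  exact: (measurable_TU_stat _ _ _ _ _ muE).
apply/seteqP; split => w /=.
  move=> [/bigmax_leP[_ h] <-]; split => // i ki.
  by have := h i ki; rewrite lee_fin lerBlDr.
move=> [<- h]; split => //; apply/bigmax_leP; split; first exact: leNye.
by move=> i ki; rewrite lee_fin lerBlDr; exact: h.
Qed.

Lemma measurable_false_rejection_counts kappa (k : {ffun 'I_M -> nat}) :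
  measurable ([set w | false_rejection f x0 e K kappa (Xat w)] `&`
    [set w | counts x0 e K (Xat w) = k]).
Proof.
pose c i := Num.sqrt (((k i)%:R - 1) / 3) * (kappa k + penalty R n (k i)).
rewrite (_ : _ `&` _ = [set w | counts x0 e K (Xat w) = k] `&`
  \bigcup_(i in [set i : 'I_M | (1 < k i)%N])
    (([set _ | increasing_on x0 (K i) f] `&`
      [set w | T_stat x0 (e i) (K i) (Xat w) < - c i]) `|`
     ([set _ | decreasing_on x0 (K i) f] `&`
      [set w | c i < T_stat x0 (e i) (K i) (Xat w)]))).
  apply: measurableI; first exact: measurable_counts.
  apply: fin_bigcup_measurable => [|i _]; first exact: finite_finset.
  (* Monotonicity of [f] does not depend on the sample, so its event is everything or empty. *)
  have mconst (Q : Prop) : measurable [set _ : T | Q].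
    have [q|q] := pselect Q.
      by rewrite (_ : mkset _ = setT)//; apply/seteqP; split.
    by rewrite (_ : mkset _ = set0)//; apply/seteqP; split.
  have mT : measurable_fun setT (fun w => T_stat x0 (e i) (K i) (Xat w)).
    by apply: measurable_T_stat => // x; exact: K0.
  apply: measurableU; apply: measurableI => //.
    by rewrite -[X in measurable X]setTI; exact: measurable_fun_ltr.
  by rewrite -[X in measurable X]setTI; exact: measurable_fun_ltr.
apply/seteqP; split => w /=.
  move=> [[i h] kE]; split => //; exists i; first by rewrite -kE; case: h => -[_ []].
  by rewrite /c -kE; case: h => -[? [_ ?]]; [left|right].
move=> [kE [i ki h]]; split => //; exists i; rewrite -kE in ki h.
by case: h => -[? h]; [left|right]; split => //; split => //; move: h;
  rewrite /c -kE.
Qed.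

(** If [f] is increasing, then [TU_stat <= T_stat < - crit]; if decreasing,
    [crit < T_stat <= TU_stat]. Either way the absolute value exceeds [crit], and rescaling gives a
    term of the maximum above [kappa]. *)
Lemma false_rejection_max_stat kappa w i :
  (forall i j, X j w \in K i ->
     forall z, z < proj x0 (e i) (X j w) ->
     mass mu x0 (e i) (K i) z < mass mu x0 (e i) (K i) (proj x0 (e i) (X j w))) ->
  increasing_on x0 (K i) f /\ rejects_increasing x0 e K kappa (Xat w) i \/
  decreasing_on x0 (K i) f /\ rejects_decreasing x0 e K kappa (Xat w) i ->
  ((kappa (counts x0 e K (Xat w)))%:E < max_stat f x0 e K (Xat w))%E.
Proof.
move=> noplateau rej.
have [mf f0 _] := hf.
have ki : (1 < counts x0 e K (Xat w) i)%N by case: rej => -[_ []].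
have TUc : crit x0 e K kappa (Xat w) i < `|TU_stat f x0 (e i) (K i) (Xat w)|.
  case: rej => -[fK [_ rej]].
    have := TU_le_T mf f0 muE d0 (noplateau i) fK.
    move=> /le_lt_trans/(_ rej); rewrite ltrNr => /lt_le_trans; apply.
    by rewrite -normrN ler_norm.
  have := T_le_TU mf f0 muE d0 (noplateau i) fK.
  by move=> /(lt_le_trans rej)/lt_le_trans; apply; exact: ler_norm.
apply: (lt_le_trans _ (le_bigmax_cond _ _ ki)).
rewrite lte_fin ltrBrDr; apply: sqrt_ratio_lt => //.
by rewrite subr_gt0 ltr1n.
Qed.

(** Inside the cell [Nk] and off a null set, a false rejection lies outside the event [E], whose
    conditional probability is [1 - alpha]. *)
Lemma probability_false_rejection_counts kappa alpha (k : {ffun 'I_M -> nat}) :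
  0 <= alpha -> is_critical_value f x0 e K X alpha kappa ->
  (P ([set w | false_rejection f x0 e K kappa (Xat w)] `&`
      [set w | counts x0 e K (Xat w) = k]) <=
   alpha%:E * P [set w | counts x0 e K (Xat w) = k])%E.
Proof.
move=> alpha0 hkappa.
set FR := [set w | _]; set Nk := [set w | _].
have mNk : measurable Nk by exact: measurable_counts.
have mFN : measurable (FR `&` Nk) by exact: measurable_false_rejection_counts.
(* [kappa k] is constrained only if some wedge has two observations and the cell has positive
   probability. Otherwise nothing is rejected or the cell is null. *)
have [[i ki]|nok] := pselect (exists i, (1 < k i)%N); last first.
  rewrite (_ : FR `&` Nk = set0) ?measure0 ?mule_ge0//.
  apply/seteqP; split => w //= [[i h] kE]; apply: nok; exists i.
  by rewrite -kE; case: h => -[_ []].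
have [PN0|PN0] := eqVneq (P Nk) 0%E.
  rewrite PN0 mule0 -[X in (_ <= X)%E]PN0.
  by rewrite le_measure ?inE.
have := hkappa k (ex_intro _ i ki) PN0.
rewrite -/Nk /cond_prob; set E := [set w | _].
have mEN : measurable (E `&` Nk) by exact: measurable_max_stat_counts.
move=> EN.
have finN : P Nk \is a fin_num by exact: fin_num_measure.
have finEN : P (E `&` Nk) \is a fin_num by exact: fin_num_measure.
have PEN : P (E `&` Nk) = ((1 - alpha)%:E * P Nk)%E.
  rewrite -(fineK finEN) -(fineK finN) -EFinM -EN divfK//.
  by rewrite fine_eq0.
have [B [mB PB badB]] := plateau_obs_negligible.
apply: (@le_trans _ _ (P ((Nk `\` (E `&` Nk)) `|` B))).
  rewrite le_measure ?inE//.
    by apply: measurableU => //; exact: measurableD.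
  move=> w [[m rej] kE]; have [Bw|nBw] := pselect (B w); [by right|left].
  split => // -[Ew _]; move: Ew; rewrite /E/= leNgt => /negP; apply.
  rewrite -kE; apply: (false_rejection_max_stat _ rej) => p j Kpj z zX.
  rewrite ltNge; apply/negP => Gz; apply/nBw/badB.
  by exists p, j; split => //; exists z.
apply: (@le_trans _ _ (P (Nk `\` (E `&` Nk)) + P B)%E).
  by apply: measureU2 => //; exact: measurableD.
have -> : P (Nk `\` (E `&` Nk)) = (P Nk - P (E `&` Nk))%E.
  rewrite measureD ?ltey_eq ?finN//.
  by rewrite (_ : Nk `&` (E `&` Nk) = E `&` Nk)//; apply: setIidr => w [].
have -> : P B = 0%E by exact: PB.
rewrite adde0 PEN.
rewrite -(fineK finN) -!EFinM -EFinB lee_fin.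
by rewrite mulrBl mul1r opprB addrC subrK.
Qed.

End false_rejection_bound.

(** * Removing the conditioning on the counts *)

Theorem theorem2p5 (R : realType) (dT : measure_display)
    (T : measurableType dT) (P : probability T R) (d n : nat)
    (hd : (0 < d)%N) (hn : (1 < n)%N)
    (f : 'rV[R]_d -> R) (hf : is_density f)
    (X : 'I_n -> {RV P >-> 'rV[R]_d})
    (hXind : independent_RVs X)
    (hXf : forall i, has_density f (X i))
    (x0 : 'rV[R]_d) (alpha : R) (halpha : 0 < alpha < 1)
    (C1 C2 eps : R) (hC1 : 0 < C1) (hC2 : 0 < C2) (heps : 0 < eps)
    (hphi : 0 < wedge_angle n C2 < pi / 2)
    (M : nat) (e : 'I_M -> 'rV[R]_d) (b : 'I_M -> 'I_d.-1 -> 'rV[R]_d)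
    (hfam : wedge_family x0 (wedge_length d n C1) (wedge_angle n C2) eps e b)
    (K : 'I_M -> set 'rV[R]_d)
    (hK : forall i,
      K i = wedge x0 (e i) (b i) (wedge_length d n C1) (wedge_angle n C2))
    (kappa : {ffun 'I_M -> nat} -> R)
    (hkappa : is_critical_value f x0 e K X alpha kappa) :
  (P [set w | false_rejection f x0 e K kappa (fun i => X i w)] <= alpha%:E)%E.
Proof.
have {hK} KE := funext hK; rewrite {K}KE in hkappa *.
set K := (fun i => wedge _ _ _ _ _) in hkappa *.
have /andP[/ltW alpha0 _] := halpha.
(* No count exceeds [n], so the count vectors range over a finite type and give a finite
   partition. *)
have counts_le w i : (counts x0 e K (fun i => X i w) i < n.+1)%N.
  rewrite ffunE nb_obsE ltnS -[leqRHS](card_ord n) -sum1_card.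
  by apply: leq_sum => j _; case: (_ \in _).
pose c w : {ffun 'I_M -> 'I_n.+1} := [ffun i => Ordinal (counts_le w i)].
have cE k : [set w | c w = k] =
    [set w | counts x0 e K (fun i => X i w) = [ffun i => k i : nat]].
  apply/seteqP; split => w /=.
    by move=> <-; apply/ffunP => i; rewrite [RHS]ffunE [c w]/c [in RHS]ffunE.
  move=> h; apply/ffunP => i; rewrite ffunE; apply/val_inj => /=.
  by rewrite h ffunE.
apply: (probability_le_cells (c := c)) => // k; rewrite cE.
- exact: measurable_false_rejection_counts.
- exact: measurable_counts.
- exact: (probability_false_rejection_counts hd (ltnW hn)).
Qed.
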